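(* Let $\alpha>-1$, $\beta>-1$ and, for $n\ge 1$, put $$\gamma_n=\frac{2n(\alpha+n)}{(2n+\alpha+\beta+1)(2n+\alpha+\beta)} .$$ Then: (i) $(\gamma_n)$ satisfies, for all $n\ge2$, the nonlinear difference equation $$c^c_{n+1}-c^c_n+\gamma_n-\gamma_{n+1}-\frac{\lambda^c_{n+1}}{\gamma_n}+\frac{\lambda^c_n}{\gamma_{n-1}}=0 .$$ (ii) For all $n\ge1$, the quasi-Christoffel Jacobi polynomial $J^{QC}_n(x;-1)=\mathcal P^{(\alpha,\beta+1)}_n(x)+\gamma_n\mathcal P^{(\alpha,\beta+1)}_{n-1}(x)$ equals $\mathcal P^{(\alpha,\beta)}_n(x)$. (iii) With $J^{QC}_0(x;-1)=1$, for all $n\ge1$, $$J^{QC}_{n+1}(x;-1)=(x-c_{n+1})J^{QC}_n(x;-1)-\lambda_{n+1}J^{QC}_{n-1}(x;-1),$$ where $$\lambda_{n+1}=\frac{4n(n+\alpha)(n+\beta)(n+\alpha+\beta)}{(2n+\alpha+\beta)^2(2n+\alpha+\beta+1)(2n+\alpha+\beta-1)},\qquad c_{n+1}=\frac{\beta^2-\alpha^2}{(2n+\alpha+\beta)(2n+\alpha+\beta+2)} .$$ (iv) The polynomials $J^{QC}_n(x;-1)$, $n\ge0$, are orthogonal with respect to $(1-x)^{\alpha}(1+x)^{\beta}\,dx$ on $(-1,1)$.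
   Context: For $a,b>-1$, $\mathcal P^{(a,b)}_n(x)$ denotes the monic Jacobi polynomial of degree $n$, i.e. the monic polynomials orthogonal on $(-1,1)$ with respect to the weight $(1-x)^a(1+x)^b$. The polynomials $\mathcal P^{(\alpha,\beta+1)}_n$ (the Christoffel transform at $-1$ of $\mathcal P^{(\alpha,\beta)}_n$) satisfy $\mathcal P^{(\alpha,\beta+1)}_{n+1}(x)=(x-c^c_{n+1})\mathcal P^{(\alpha,\beta+1)}_n(x)-\lambda^c_{n+1}\mathcal P^{(\alpha,\beta+1)}_{n-1}(x)$ for $n\ge1$ with $$\lambda^c_{n+1}=\frac{4n(n+\alpha)(n+\beta+1)(n+\alpha+\beta+1)}{(2n+\alpha+\beta+1)^2(2n+\alpha+\beta+2)(2n+\alpha+\beta)},\qquad c^c_{n+1}=\frac{(\beta+1)^2-\alpha^2}{(2n+\alpha+\beta+1)(2n+\alpha+\beta+3)} .$$ Convention: for $n=1$ the common factor $1+\alpha+\beta$ in the numerator and denominator of $\lambda_2$ is cancelled (this matters only when $\alpha+\beta=-1$). A family of polynomials $(p_n)_{n\ge n_0}$ is orthogonal with respect to a measure $\mu$ if $\int p_np_m\,d\mu$ converges absolutely for all $n,m\ge n_0$, is $0$ for $n\ne m$ and is nonzero for $n=m$. *)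

(* Defs.v *)
From HB Require Import structures.
From mathcomp Require Import all_boot all_order all_algebra.
From mathcomp Require Import all_classical all_reals all_analysis.
Set Implicit Arguments.
Unset Strict Implicit.
Unset Printing Implicit Defensive.
Import Order.TTheory GRing.Theory Num.Theory.
Import numFieldNormedType.Exports.
Local Open Scope classical_set_scope.
Local Open Scope ring_scope.

(* [p] is orthogonal with respect to the measure w(x) dx on D.
   Integrability is absolute convergence of the integral; the second integral
   is the real-valued [Rintegral]. *)
Definition orthogonal_wrt (R : realType) (w : R -> R) (D : set R)
    (p : nat -> {poly R}) : Prop :=
  forall n m : nat,
    let f := fun x : R => (p n).[x] * (p m).[x] * w x in
    (@lebesgue_measure R).-integrable D (EFin \o f) /\
    (n <> m -> \int[@lebesgue_measure R]_(x in D) f x = 0) /\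
    (n = m -> \int[@lebesgue_measure R]_(x in D) f x <> 0).

Definition jacobi_weight (R : realType) (a b : R) (x : R) : R :=
  (1 - x) `^ a * (1 + x) `^ b.

Definition jacobi_interval (R : realType) : set R := `]-1, 1[.

Definition is_monic_jacobi (R : realType) (a b : R) (p : nat -> {poly R}) :
    Prop :=
  (forall n : nat, p n \is monic /\ size (p n) = n.+1) /\
  orthogonal_wrt (jacobi_weight a b) (@jacobi_interval R) p.

(* For a, b > -1 exactly one family satisfies [is_monic_jacobi a b]; [xget]
   selects it. The default value (the zero family) is not monic, so it is only
   returned when no such family exists. *)
Definition jacobi (R : realType) (a b : R) : nat -> {poly R} :=
  xget (fun _ : nat => 0) [set p : nat -> {poly R} | is_monic_jacobi a b p].

(* Coefficients are indexed by their own subscript: a formula stated for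
   c_{n+1} or lambda_{n+1} is read at k = n + 1, whence n := k.-1. *)

Definition lambda_c (R : realType) (alpha beta : R) (k : nat) : R :=
  let n : R := (k.-1)%:R in
  (4 * n * (n + alpha) * (n + beta + 1) * (n + alpha + beta + 1)) /
  ((2 * n + alpha + beta + 1) ^+ 2 * (2 * n + alpha + beta + 2)
     * (2 * n + alpha + beta)).

Definition c_c (R : realType) (alpha beta : R) (k : nat) : R :=
  let n : R := (k.-1)%:R in
  ((beta + 1) ^+ 2 - alpha ^+ 2) /
  ((2 * n + alpha + beta + 1) * (2 * n + alpha + beta + 3)).

(* For k = 2, i.e. n = 1, the factors n + alpha + beta and
   2 n + alpha + beta - 1 coincide and are cancelled, which gives the correct
   value also when alpha + beta = -1. *)
Definition lambda_J (R : realType) (alpha beta : R) (k : nat) : R :=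
  let n : R := (k.-1)%:R in
  if k == 2%N then
    (4 * n * (n + alpha) * (n + beta)) /
    ((2 * n + alpha + beta) ^+ 2 * (2 * n + alpha + beta + 1))
  else
    (4 * n * (n + alpha) * (n + beta) * (n + alpha + beta)) /
    ((2 * n + alpha + beta) ^+ 2 * (2 * n + alpha + beta + 1)
       * (2 * n + alpha + beta - 1)).

Definition c_J (R : realType) (alpha beta : R) (k : nat) : R :=
  let n : R := (k.-1)%:R in
  (beta ^+ 2 - alpha ^+ 2) /
  ((2 * n + alpha + beta) * (2 * n + alpha + beta + 2)).

Definition gamma_QC (R : realType) (alpha beta : R) (n : nat) : R :=
  (2 * n%:R * (alpha + n%:R)) /
  ((2 * n%:R + alpha + beta + 1) * (2 * n%:R + alpha + beta)).

(* The quasi-Christoffel Jacobi polynomials J^{QC}_n(x; -1). *)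
Definition JQC (R : realType) (alpha beta : R) (n : nat) : {poly R} :=
  if n is m.+1 then
    jacobi alpha (beta + 1) m.+1
      + gamma_QC alpha beta m.+1 *: jacobi alpha (beta + 1) m
  else 1.

(* Main.v *)
Require Import Defs.
From HB Require Import structures.
From mathcomp Require Import all_boot all_order all_algebra.
From mathcomp Require Import all_classical all_reals all_analysis.
From mathcomp Require Import measurable_realfun.
From mathcomp Require Import zify ring lra.
Set Implicit Arguments.
Unset Strict Implicit.
Unset Printing Implicit Defensive.
Import Order.TTheory GRing.Theory Num.Theory.
Import numFieldNormedType.Exports.
Local Open Scope classical_set_scope.
Local Open Scope ring_scope.

(** Write w for the weight (1-x)^a (1+x)^b on (-1,1), with a, b > -1, and
    L p for the integral of p w. Two properties of L carry the proof. It is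
    positive definite: L (p^2) > 0 for p <> 0 ([jacobi_integral_gt0]). And
    since (1-x^2) w p vanishes at both endpoints, integrating its derivative
    gives Pearson's identity L ((1-x^2) p' + tau p) = 0, where
    tau = b - a - (a+b+2) x ([jacobi_integral_pearson]).

    By Pearson's identity the differential operator
    D q = (1-x^2) q'' + tau q' is symmetric for L. It is also triangular in the
    powers of x, with the distinct diagonal entries - n (n+a+b+1). So it has a
    monic eigenpolynomial in each degree ([jacobi_eigenpolynomial]), and these
    are orthogonal ([pearson_orthogonal]). As monic orthogonal polynomials are
    unique, they are the Jacobi polynomials ([jacobi_eigenseqP]), and the
    eigenvalue equation yields the coefficients of x^(n-1) and x^(n-2) in
    closed form ([eigenseq_subleading_coef], [eigenseq_third_coef]).

    Both identities between Jacobi polynomials then have the same proof. The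
    difference of the two sides is orthogonal to all polynomials of degree less
    than n, and its coefficients of degree at least n vanish by these closed
    forms, which is where gamma_n, c_n and lambda_n come from; being orthogonal
    to itself, the difference is 0 ([orthogonal_self_eq0]). For the three-term
    recurrence ([eigenseq_three_term]) the weight is w. For the
    quasi-Christoffel identity ([eigenseq_christoffel]) it is (1+x) w, the
    weight with parameters a and b+1, and integrating against it is applying L
    after multiplication by 1+x. The nonlinear difference
    equation for gamma_n is an identity of rational functions of n, a and b
    whose denominators do not vanish. *)

(** * Integrals of derivatives over an open interval *)

Section ImproperIntegral.
Variables (R : realType) (f F : R -> R) (a b : R).
Notation mu := (@lebesgue_measure R).
Hypotheses (ab : a < b) (Fab : derivable_oo_LRcontinuous F a b).
Hypothesis f_cont : {in `]a, b[, continuous f}.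
Hypothesis F_deriv : {in `]a, b[, derive1 F =1 f}.

Lemma FTC_compact_subinterval u v : a < u -> u < v -> v < b ->
  (\int[mu]_(x in `[u, v]) (f x)%:E = (F v)%:E - (F u)%:E)%E.
Proof.
move=> au uv vb.
have sub x : x \in `[u, v] -> x \in `]a, b[.
  by rewrite !in_itv /= => /andP[ux xv]; rewrite (lt_le_trans au) //= (le_lt_trans xv).
have [dF _ _] := Fab.
have cF x : x \in `]a, b[ -> {for x, continuous F}.
  by move=> /dF/derivable1_diffP/differentiable_continuous.
apply: continuous_FTC2 => //.
- apply: continuous_in_subspaceT => x; rewrite inE /= => /sub; exact: f_cont.
- split.
  + by move=> x xuv; apply: dF; apply: sub; exact: subset_itv_oo_cc xuv.
  + by apply: cvg_at_right_filter; apply: cF; apply: sub; rewrite bound_itvE ltW.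
  + by apply: cvg_at_left_filter; apply: cF; apply: sub; rewrite bound_itvE ltW.
- by move=> x xuv; apply: F_deriv; apply: sub; exact: subset_itv_oo_cc xuv.
Qed.

Let f_meas : measurable_fun `]a, b[ f.
Proof.
apply: open_continuous_measurable_fun => //.
by move=> x; rewrite inE /=; exact: f_cont.
Qed.

(** The integrals over the compact intervals [a + h, b - h] are
    F (b - h) - F (a + h), and they increase to the integral over ]a, b[, which
    is therefore F b - F a, hence finite. *)
Lemma ge0_derivative_integrable :
  {in `]a, b[, forall x, 0 <= f x} -> mu.-integrable `]a, b[ (EFin \o f).
Proof.
move=> f0.
(* The factor 1/3 keeps a + h n below b - h n. *)
pose h (n : nat) : R := (b - a) / 3 * harmonic n.
have h0 n : 0 < h n by rewrite mulr_gt0 ?divr_gt0 ?subr_gt0 // /harmonic /= invr_gt0.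
have h1 n : 2 * h n < b - a.
  have : h n <= (b - a) / 3.
    by rewrite ger_pMr ?divr_gt0 ?subr_gt0 // /harmonic /= invf_le1 // ler1n.
  by have := ab; lra.
have h_dec m n : (m <= n)%N -> h n <= h m.
  move=> mn; rewrite ler_pM2l ?divr_gt0 ?subr_gt0 // /harmonic /= lef_pV2 ?posrE //.
  by rewrite ler_nat ltnS.
have h_cvg : h n @[n --> \oo] --> 0.
  by rewrite -(mulr0 ((b - a) / 3)); apply: cvgMr; exact: cvg_harmonic.
pose E n : set R := [set` `[a + h n, b - h n]].
have EU : \bigcup_n E n = [set` `]a, b[].
  apply/seteqP; split=> x /=.
    move=> [n _]; rewrite /E /= !in_itv /=. move=> /andP[xa xb].
    by have hn := h0 n; apply/andP; split; lra.
  rewrite in_itv /= => /andP[ax xb].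
  have xa0 : 0 < x - a by rewrite subr_gt0.
  have bx0 : 0 < b - x by rewrite subr_gt0.
  have [n _ /(_ n (leqnn n))[n1 n2]] : \forall n \near \oo, h n < x - a /\ h n < b - x.
    by near=> n; split; near: n; apply: cvgr_lt h_cvg _ _.
  by exists n => //; rewrite /E /= in_itv /=; apply/andP; split; lra.
have Fl : F (a + h n) @[n --> \oo] --> F a.
  have [_ /cvg_at_rightP Fa _] := Fab; apply: Fa; split=> [n|].
    by rewrite ltrDl.
  by rewrite -[X in _ --> X]addr0; apply: cvgD h_cvg; exact: cvg_cst.
have Fr : F (b - h n) @[n --> \oo] --> F b.
  have [_ _ /cvg_at_leftP Fb] := Fab; apply: Fb; split=> [n|].
    by rewrite ltrBlDr ltrDl.
  by rewrite -[X in _ --> X]subr0; apply: cvgB h_cvg; exact: cvg_cst.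
have Eint n : (\int[mu]_(x in E n) (f x)%:E = (F (b - h n) - F (a + h n))%:E)%E.
  have := h0 n; have := h1 n => hn hn0.
  by rewrite /E FTC_compact_subinterval ?EFinB //; lra.
have sE n : E n `<=` `]a, b[ by rewrite -EU; exact: bigcup_sup.
have intE : (\int[mu]_(x in `]a, b[) (f x)%:E = (F b - F a)%:E)%E.
  have H : (\int[mu]_(x in E n) (f x)%:E @[n --> \oo] -->
      \int[mu]_(x in \bigcup_n E n) (f x)%:E)%E.
    apply: ge0_nondecreasing_set_cvg_integral => [m n /h_dec hmn|n|n|n x /sE xab].
    - apply/subsetPset => x; rewrite /E /= !in_itv /= => /andP[xa xb].
      by apply/andP; split; lra.
    - by rewrite /E; exact: measurable_itv.
    - by apply/measurable_EFinP; apply: measurable_funS f_meas.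
    - by rewrite lee_fin; exact: f0.
  rewrite EU in H; apply: (cvg_unique _ H) => //.
  rewrite (_ : (fun n => _) = (fun n => (F (b - h n) - F (a + h n))%:E)).
    by apply: cvg_EFin; [exact: nearW|exact: cvgB].
  by apply/funext => n; exact: Eint.
apply/integrableP; split; first exact/measurable_EFinP.
rewrite (_ : (\int[mu]_(x in _) _)%E = \int[mu]_(x in `]a, b[) (f x)%:E)%E.
  by rewrite intE ltry.
apply: eq_integral => x; rewrite inE /= => xab.
by rewrite ger0_norm //; exact: f0.
Unshelve. all: by end_near.
Qed.

Let integrable_cc : mu.-integrable `]a, b[ (EFin \o f) ->
  mu.-integrable `[a, b] (EFin \o f).
Proof.
move=> /integrableP[mf fi]; apply/integrableP; split.
  by apply/measurable_EFinP; exact: measurable_fun_itv_cc f_meas.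
rewrite integral_itv_bndoo //; exact: measurableT_comp.
Qed.

(** The integral I from a to x of an integrable f is continuous on [a, b], and
    I - F is constant inside; comparing its limits at both ends gives the
    result even when f is unbounded near the endpoints. *)
Lemma integrable_FTC : mu.-integrable `]a, b[ (EFin \o f) ->
  \int[mu]_(x in `]a, b[) f x = F b - F a.
Proof.
move=> fi; have fcc := integrable_cc fi.
pose I x := parameterized_integral mu a x f.
have IFE u v : a < u -> u < v -> v < b -> I v - F v = I u - F u.
  move=> au uv vb.
  have fv : mu.-integrable `[a, v] (EFin \o f).
    by apply: integrableS fcc => //; apply: subset_itvl; rewrite bnd_simp ltW.
  have fuv : mu.-integrable `[u, v] (EFin \o f).
    by apply: integrableS fv => //; apply: subset_itvr; rewrite bnd_simp ltW.
  have : I v - I u = F v - F u.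
    rewrite /I /parameterized_integral Rintegral_itvB ?bnd_simp //; [|exact: ltW..].
    rewrite Rintegral_itv_obnd_cbnd; last first.
      by apply: integrableS fuv => //; exact: subset_itv_oc_cc.
    by rewrite /Rintegral FTC_compact_subinterval.
  lra.
have [_ Fa Fb] := Fab.
have IFb u : a < u -> u < b -> I b - F b = I u - F u.
  move=> au ub; have H : I v - F v @[v --> b^'-] --> I b - F b.
    by apply: cvgB => //; exact: parameterized_integral_cvg_at_left.
  rewrite -(cvg_lim _ H) //; apply: lim_near_cst => //.
  by near=> v; exact: IFE.
have IFa : I b - F b = 0 - F a.
  have H : I u - F u @[u --> a^'+] --> 0 - F a.
    apply: cvgB => //; apply: cvg_at_right_filter.
    exact: (parameterized_integral_cvg_left ab).
  rewrite -(cvg_lim _ H) //; apply/esym; apply: lim_near_cst => //.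
  by near=> u; apply/esym/IFb.
have -> : \int[mu]_(x in `]a, b[) f x = I b.
  rewrite /I /parameterized_integral /Rintegral [in RHS]integral_itv_bndoo //.
  exact/measurable_EFinP.
by move: IFa; lra.
Unshelve. all: by end_near.
Qed.

End ImproperIntegral.

(** * Integration against the Jacobi weight *)

Section Weight.
Variable (R : realType).
Notation mu := (@lebesgue_measure R).
Notation J := [set` (`]-1, 1[ : interval R)].
Implicit Types (a b r x : R) (p : {poly R}).

Lemma in_jacobi_interval x : (x \in `]-1, 1[) = (0 < 1 + x) && (0 < 1 - x).
Proof. by rewrite in_itv /= -ltrBlDl sub0r subr_gt0. Qed.

Lemma is_derive_powR_1D r x : 0 < 1 + x ->
  is_derive x 1 (fun y : R => (1 + y) `^ r) (r * (1 + x) `^ (r - 1)).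
Proof.
move=> x0.
have H1 : is_derive x 1 (fun y : R => 1 + y) 1.
  have := is_deriveD (is_derive_cst (1 : R) x 1) (is_derive_id x (1 : R)).
  by rewrite add0r.
have H2 := is_derive1_powR r x0.
have := @is_derive1_comp R (@powR R ^~ r) (fun y : R => 1 + y) x _ _ H2 H1.
by rewrite mulr1.
Qed.

Lemma is_derive_powR_1B r x : 0 < 1 - x ->
  is_derive x 1 (fun y : R => (1 - y) `^ r) (- (r * (1 - x) `^ (r - 1))).
Proof.
move=> x0.
have H1 : is_derive x 1 (fun y : R => 1 - y) (-1).
  have := is_deriveB (is_derive_cst (1 : R) x 1) (is_derive_id x (1 : R)).
  by rewrite sub0r.
have H2 := is_derive1_powR r x0.
have := @is_derive1_comp R (@powR R ^~ r) (fun y : R => 1 - y) x _ _ H2 H1.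
by rewrite mulrN1.
Qed.

Lemma cvg_powR_1D r : 0 < r -> (1 + x) `^ r @[x --> (-1)^'+] --> 0.
Proof.
move=> r0; apply/cvgrPdist_lt => e e0.
have /cvgrPdist_lt /(_ e e0) := powR_cvg0 r0.
move=> [d /= d0 H]; exists d => //= y /= yd y1.
apply: H; last by lra.
by rewrite /= sub0r opprD.
Qed.

Lemma cvg_powR_1B r : 0 < r -> (1 - x) `^ r @[x --> 1^'-] --> 0.
Proof.
move=> r0; apply/cvgrPdist_lt => e e0.
have /cvgrPdist_lt /(_ e e0) := powR_cvg0 r0.
move=> [d /= d0 H]; exists d => //= y /= yd y1.
apply: H; last by lra.
by rewrite /= sub0r normrN.
Qed.

Lemma jacobi_weight_continuous a b : {in `]-1, 1[, continuous (@jacobi_weight R a b)}.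
Proof.
move=> x; rewrite in_jacobi_interval => /andP[x1 x2].
have [d1 _] := is_derive_powR_1B a x2.
have [d2 _] := is_derive_powR_1D b x1.
rewrite /continuous_at /jacobi_weight; apply: cvgM.
  by move/derivable1_diffP/differentiable_continuous : d1.
by move/derivable1_diffP/differentiable_continuous : d2.
Qed.

Lemma jacobi_weight_gt0 a b x : x \in `]-1, 1[ -> 0 < jacobi_weight a b x.
Proof.
rewrite in_jacobi_interval => /andP[x1 x2].
by rewrite /jacobi_weight mulr_gt0 // powR_gt0.
Qed.

Lemma powR_1D_integrable b : -1 < b ->
  mu.-integrable J (EFin \o (fun x => (1 + x) `^ b)).
Proof.
move=> b1; have b0 : 0 < b + 1 by lra.
have bn0 : b + 1 != 0 by rewrite gt_eqF.
have dF x : 0 < 1 + x ->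
    is_derive x 1 (fun y => (b + 1)^-1 * (1 + y) `^ (b + 1)) ((1 + x) `^ b).
  move=> x0; have H := is_derive_powR_1D (b + 1) x0.
  apply: (is_derive_eq (is_deriveZ (b + 1)^-1 H)).
  by rewrite addrK /GRing.scale /= mulrA mulVf // mul1r.
apply: (@ge0_derivative_integrable _ _
  (fun x => (b + 1)^-1 * (1 + x) `^ (b + 1))) => //.
- split.
  + by move=> x; rewrite in_jacobi_interval => /andP[/dF[]].
  + rewrite subrr powR0 // mulr0 -[X in _ --> X](mulr0 (b + 1)^-1).
    apply: cvgMr; exact: cvg_powR_1D.
  + apply: cvg_at_left_filter.
    have [] := dF 1; first by lra.
    by move=> /derivable1_diffP/differentiable_continuous.
- move=> x; rewrite in_jacobi_interval => /andP[x0 _].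
  have [d2 _] := is_derive_powR_1D b x0.
  by move/derivable1_diffP/differentiable_continuous : d2.
- move=> x; rewrite in_jacobi_interval => /andP[/dF[_ H] _].
  by rewrite derive1E H.
- by move=> x _; exact: powR_ge0.
Qed.

Lemma powR_1B_integrable a : -1 < a ->
  mu.-integrable J (EFin \o (fun x => (1 - x) `^ a)).
Proof.
move=> a1; have a0 : 0 < a + 1 by lra.
have an0 : a + 1 != 0 by rewrite gt_eqF.
have dF x : 0 < 1 - x ->
    is_derive x 1 (fun y => - (a + 1)^-1 * (1 - y) `^ (a + 1)) ((1 - x) `^ a).
  move=> x0; have H := is_derive_powR_1B (a + 1) x0.
  apply: (is_derive_eq (is_deriveZ (- (a + 1)^-1) H)).
  by rewrite addrK /GRing.scale /= mulrNN mulrA mulVf // mul1r.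
apply: (@ge0_derivative_integrable _ _
  (fun x => - (a + 1)^-1 * (1 - x) `^ (a + 1))) => //.
- split.
  + by move=> x; rewrite in_jacobi_interval => /andP[_ /dF[]].
  + apply: cvg_at_right_filter.
    have [] := dF (-1); first by lra.
    by move=> /derivable1_diffP/differentiable_continuous.
  + rewrite subrr powR0 // mulr0 -[X in _ --> X](mulr0 (- (a + 1)^-1)).
    apply: cvgMr; exact: cvg_powR_1B.
- move=> x; rewrite in_jacobi_interval => /andP[_ x0].
  have [d2 _] := is_derive_powR_1B a x0.
  by move/derivable1_diffP/differentiable_continuous : d2.
- move=> x; rewrite in_jacobi_interval => /andP[_ /dF[_ H]].
  by rewrite derive1E H.
- by move=> x _; exact: powR_ge0.
Qed.

Lemma jacobi_weight_measurable a b : measurable_fun J (@jacobi_weight R a b).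
Proof.
apply: open_continuous_measurable_fun => //.
by move=> x; rewrite inE /=; exact: jacobi_weight_continuous.
Qed.

Lemma powR_le_absr r x : 1 <= x <= 2 -> x `^ r <= 2 `^ `|r|.
Proof.
move=> /andP[x1 x2]; have x0 : 0 < x by lra.
apply: (@le_trans _ _ (x `^ `|r|)).
  by apply: ler_powR => //; exact: ler_norm.
by apply: ge0_ler_powR => //; rewrite nnegrE //; exact: ltW.
Qed.

(** On each half of the interval one of the two factors is bounded, so the
    weight is dominated by a combination of (1+x)^b and (1-x)^a. *)
Lemma jacobi_weight_integrable a b : -1 < a -> -1 < b ->
  mu.-integrable J (EFin \o jacobi_weight a b).
Proof.
move=> a1 b1.
pose g x : R := 2 `^ `|a| * (1 + x) `^ b + 2 `^ `|b| * (1 - x) `^ a.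
have gi : mu.-integrable J (EFin \o g).
  apply: (@eq_integrable _ _ _ mu _ _
    (fun x => ((2 `^ `|a|)%:E * ((1 + x) `^ b)%:E
               + (2 `^ `|b|)%:E * ((1 - x) `^ a)%:E)%E)) => //.
  apply: integrableD => //; apply: integrableZl => //.
    exact: powR_1D_integrable.
  exact: powR_1B_integrable.
apply: le_integrable gi => //.
  by apply/measurable_EFinP; exact: jacobi_weight_measurable.
move=> x /= xI; rewrite lee_fin.
rewrite !ger0_norm; last 2 first.
- by rewrite addr_ge0 // mulr_ge0 ?powR_ge0.
- by rewrite ltW // jacobi_weight_gt0.
move: xI; rewrite in_jacobi_interval => /andP[x1 x2].
rewrite /jacobi_weight /g; have [x0|x0] := leP x 0.
  apply: (@le_trans _ _ (2 `^ `|a| * (1 + x) `^ b)).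
    by rewrite ler_wpM2r ?powR_ge0 // powR_le_absr //; lra.
  by rewrite lerDl mulr_ge0 ?powR_ge0.
apply: (@le_trans _ _ (2 `^ `|b| * (1 - x) `^ a)).
  by rewrite mulrC ler_wpM2r ?powR_ge0 // powR_le_absr //; lra.
by rewrite lerDr mulr_ge0 ?powR_ge0.
Qed.

Lemma poly_jacobi_integrable a b p : -1 < a -> -1 < b ->
  mu.-integrable J (EFin \o (fun x => p.[x] * jacobi_weight a b x)).
Proof.
move=> a1 b1.
have pb : [bounded p.[x] | x in J].
  have pc : compact (horner p @` [set` `[-1, 1] : interval R]).
    apply: continuous_compact; last exact: segment_compact.
    by apply: continuous_subspaceT => x; exact: continuous_horner.
  have [M [Mr HM]] := compact_bounded pc.
  exists M; split=> // y My x /= xI; apply: (HM y My); exists x => //=.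
  exact: subset_itv_oo_cc xI.
have mJ : measurable J by exact: measurable_itv.
have H := @integrableMr _ (measurableTypeR R) R mu J mJ (horner p)
  (EFin \o jacobi_weight a b) (measurable_poly (A := J) p) pb
  (jacobi_weight_integrable a1 b1).
by apply: eq_integrable H => // x _; rewrite /= EFinM.
Qed.

Definition jacobi_integral a b p : R :=
  \int[mu]_(x in @jacobi_interval R) (p.[x] * jacobi_weight a b x).

Lemma jacobi_integral_scalar a b : -1 < a -> -1 < b -> scalar (jacobi_integral a b).
Proof.
move=> a1 b1 c p q; rewrite /jacobi_integral /jacobi_interval.
have pi := poly_jacobi_integrable p a1 b1.
rewrite -RintegralZl //=.
rewrite -RintegralD //=; last exact: poly_jacobi_integrable.
  by apply: eq_Rintegral => x _; rewrite hornerD hornerZ mulrDl -mulrA.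
have := poly_jacobi_integrable (c *: p) a1 b1.
by apply: eq_integrable => // x _; rewrite /= hornerZ -mulrA.
Qed.

Lemma root_set_negligible p : p != 0 -> mu.-negligible [set x | root p x].
Proof.
move=> p0; have fin : finite_set [set x | root p x].
  apply: contrapT => /(infinite_set_fset (size p))[B BA].
  apply/negP; rewrite -ltnNge; apply: max_poly_roots => //.
    by apply/allP => x xB; exact: BA.
  exact: finmap.fset_uniq.
have cnt := finite_set_countable fin.
apply/negligibleP; last exact: countable_lebesgue_measure0.
by apply: countable_measurable cnt => t; exact: measurable_set1.
Qed.

(** If the integral of the nonnegative function p^2 w vanished, then p would be
    0 almost everywhere on ]-1, 1[, but a nonzero polynomial has only finitely
    many roots. *)
Lemma jacobi_integral_gt0 a b p : -1 < a -> -1 < b -> p != 0 ->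
  0 < jacobi_integral a b (p * p).
Proof.
move=> a1 b1 p0.
have f0 x : x \in `]-1, 1[ -> 0 <= (p * p).[x] * jacobi_weight a b x.
  by move=> xI; rewrite hornerM mulr_ge0 -?expr2 ?sqr_ge0 // ltW // jacobi_weight_gt0.
rewrite lt_neqAle; apply/andP; split; last first.
  by apply: Rintegral_ge0 => x; exact: f0.
apply/eqP => /esym I0.
have fi := poly_jacobi_integrable (p * p) a1 b1.
have : (\int[mu]_(x in J) `|((p * p).[x] * jacobi_weight a b x)%:E| = 0)%E.
  rewrite (_ : (\int[mu]_(x in _) _)%E =
    \int[mu]_(x in J) ((p * p).[x] * jacobi_weight a b x)%:E)%E; last first.
    by apply: eq_integral => x; rewrite inE /= => xI; rewrite ger0_norm // f0.
  rewrite -[LHS]fineK; first by congr (_%:E).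
  by apply: integrable_fin_num => //; exact: fi.
move/ae_eq_integral_abs => /(_ (measurable_itv _) (measurable_int _ fi)) ae0.
have : mu.-negligible J.
  apply: negligibleS (negligibleU ae0 (root_set_negligible p0)) => x /= xI.
  have [px|px] := boolP (root p x); [by right|left=> /(_ xI)].
  apply/eqP; rewrite eqe mulf_neq0 //.
    by rewrite hornerM mulf_neq0.
  by rewrite gt_eqF // jacobi_weight_gt0.
move=> Jn; have : mu J = 0%E by exact: measure_negligible.
rewrite lebesgue_measure_itv /= lte_fin ifT; last by lra.
by rewrite -EFinD => /eqP; rewrite eqe; lra.
Qed.

Lemma jacobi_integral_christoffel a b p :
  jacobi_integral a (b + 1) p = jacobi_integral a b (p * ('X + 1)).
Proof.
apply: eq_Rintegral => x; rewrite inE /= /jacobi_interval /= in_jacobi_interval.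
move=> /andP[x1 _]; rewrite /jacobi_weight powRD; last first.
  by rewrite (gt_eqF x1) implybT.
by rewrite (powRr1 (ltW x1)) hornerM hornerD hornerX hornerC; ring.
Qed.

(** The integrand is the derivative of p (1-x)^(a+1) (1+x)^(b+1), which vanishes
    at both endpoints because a + 1 and b + 1 are positive. *)
Lemma jacobi_integral_pearson a b p : -1 < a -> -1 < b ->
  jacobi_integral a b
    ((1 - 'X ^+ 2) * p^`() + ((b - a)%:P - (a + b + 2) *: 'X) * p) = 0.
Proof.
move=> a1 b1.
set q := (X in jacobi_integral a b X).
pose F x := p.[x] * ((1 - x) `^ (a + 1) * (1 + x) `^ (b + 1)).
have FE : F 1 = 0 /\ F (-1) = 0.
  by rewrite /F !subrr !powR0 ?mul0r ?mulr0 //; apply: lt0r_neq0; lra.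
have dF x : x \in `]-1, 1[ -> is_derive x 1 F (q.[x] * jacobi_weight a b x).
  rewrite in_jacobi_interval => /andP[x1 x2].
  have H1 := is_derive_powR_1B (a + 1) x2.
  have H2 := is_derive_powR_1D (b + 1) x1.
  apply: (is_derive_eq (is_deriveM (is_derive_poly p x) (is_deriveM H1 H2))).
  rewrite /q /jacobi_weight !addrK /GRing.scale !fctE /=.
  rewrite !powRD ?(gt_eqF x1) ?(gt_eqF x2) ?implybT //.
  rewrite (powRr1 (ltW x1)) (powRr1 (ltW x2)).
  by rewrite !(hornerM, hornerD, hornerN, hornerZ, hornerX, hornerC, hornerXn); ring.
have cp : continuous (horner p) by exact: continuous_horner.
rewrite /jacobi_integral (@integrable_FTC _ _ F).
- by have [-> ->] := FE; rewrite subrr.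
- by lra.
- have [F1 F2] := FE; split.
  + by move=> x /dF[].
  + rewrite F2 -[X in _ --> X](mulr0 p.[-1]); apply: cvgM.
      by apply: cvg_at_right_filter; exact: cp.
    rewrite -[X in _ --> X](mulr0 ((1 - -1) `^ (a + 1))); apply: cvgM.
      apply: cvg_at_right_filter.
      have [] := @is_derive_powR_1B (a + 1) (-1); first by lra.
      by move=> /derivable1_diffP/differentiable_continuous.
    by apply: cvg_powR_1D; lra.
  + rewrite F1 -[X in _ --> X](mulr0 p.[1]); apply: cvgM.
      by apply: cvg_at_left_filter; exact: cp.
    rewrite -[X in _ --> X](mul0r ((1 + 1) `^ (b + 1))); apply: cvgM.
      by apply: cvg_powR_1B; lra.
    apply: cvg_at_left_filter.
    have [] := @is_derive_powR_1D (b + 1) 1; first by lra.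
    by move=> /derivable1_diffP/differentiable_continuous.
- move=> x xI; rewrite /continuous_at; apply: cvgM; first exact: continuous_horner.
  exact: jacobi_weight_continuous.
- by move=> x /dF[_ H]; rewrite derive1E H.
- exact: poly_jacobi_integrable.
Qed.

End Weight.

(** * Monic orthogonal polynomials for a positive definite functional *)

Section OrthogonalPolynomials.
Variables (R : realType) (L : {scalar {poly R}}).
Hypothesis L_posdef : forall p : {poly R}, p != 0 -> 0 < L (p * p).

Definition monic_seq (P : nat -> {poly R}) : Prop :=
  forall n, P n \is monic /\ size (P n) = n.+1.

Lemma monic_seq_coef (P : nat -> {poly R}) n : monic_seq P -> (P n)`_n = 1.
Proof. by move=> /(_ n)[/monicP + sP]; rewrite lead_coefE sP. Qed.

Lemma monic_seq_coef_gt (P : nat -> {poly R}) n k :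
  monic_seq P -> (n < k)%N -> (P n)`_k = 0.
Proof. by move=> /(_ n)[_ sP] nk; rewrite nth_default ?sP. Qed.

Lemma size_leS_eq0 n (p : {poly R}) :
  (size p <= n.+1)%N -> p`_n = 0 -> (size p <= n)%N.
Proof.
move=> sp pn; apply/leq_sizeP => j; rewrite leq_eqVlt => /predU1P[<-//|nj].
by move/leq_sizeP : sp; apply.
Qed.

(** A polynomial of degree less than n is a combination of P 0, ..., P (n-1). *)
Lemma orthogonal_lower_degree (P : nat -> {poly R}) (n : nat) (q : {poly R}) :
  monic_seq P -> (forall i j, i <> j -> L (P i * P j) = 0) ->
  (size q <= n)%N -> L (q * P n) = 0.
Proof.
move=> mP oP; have : (n <= n)%N by [].
elim: {1 3}n q => [|m IHm] q mn sq.
  by move: sq; rewrite size_poly_leq0 => /eqP ->; rewrite mul0r linear0.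
have -> : q = q`_m *: P m + (q - q`_m *: P m) by rewrite addrC subrK.
rewrite mulrDl -scalerAl linearD linearZ /= oP ?mulr0 ?add0r; last first.
  by move=> mE; move: mn; rewrite mE ltnn.
apply: IHm; first exact: ltnW.
apply: size_leS_eq0.
  apply/leq_sizeP => j mj; rewrite coefB coefZ (monic_seq_coef_gt mP) ?mulr0 ?subr0 //.
  by move/leq_sizeP : sq; apply.
by rewrite coefB coefZ (monic_seq_coef _ mP) mulr1 subrr.
Qed.

Lemma orthogonal_self_eq0 n (q : {poly R}) : (size q <= n)%N ->
  (forall r : {poly R}, (size r <= n)%N -> L (r * q) = 0) -> q = 0.
Proof.
move=> sq oq; apply/eqP; apply: contraT => /L_posdef.
by rewrite oq ?ltxx.
Qed.

Lemma monic_orthogonal_unique (P Q : nat -> {poly R}) :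
  monic_seq P -> (forall i j, i <> j -> L (P i * P j) = 0) ->
  monic_seq Q -> (forall i j, i <> j -> L (Q i * Q j) = 0) ->
  forall n, P n = Q n.
Proof.
move=> mP oP mQ oQ n; apply/eqP; rewrite -subr_eq0; apply/eqP.
apply: (@orthogonal_self_eq0 n).
  apply: size_leS_eq0; last first.
    by rewrite coefB (monic_seq_coef _ mP) (monic_seq_coef _ mQ) subrr.
  apply/leq_sizeP => j nj; rewrite coefB.
  by rewrite (monic_seq_coef_gt mP) // (monic_seq_coef_gt mQ) // subrr.
by move=> r sr; rewrite mulrBr linearB /= !orthogonal_lower_degree // subrr.
Qed.

End OrthogonalPolynomials.

(** * The Jacobi differential operator and its eigenpolynomials *)

Section JacobiOperator.
Variables (R : realType) (a b : R).
Hypotheses (a1 : -1 < a) (b1 : -1 < b).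
Implicit Types (p q r : {poly R}) (k m n : nat).

(** (1 - x^2) w has the derivative [jacobi_tau] * w, where w is the Jacobi
    weight with parameters a and b. *)
Definition jacobi_tau : {poly R} := (b - a)%:P - (a + b + 2) *: 'X.

(** The operator of the Jacobi differential equation, that is
    ((1 - x^2) w q')' / w. *)
Definition jacobi_op q : {poly R} :=
  (1 - 'X ^+ 2) * q^`()^`() + jacobi_tau * q^`().

(** The eigenvalues of minus the operator. *)
Definition jacobi_eigenvalue k : R := k%:R * (k%:R + a + b + 1).

Let coef_deriv_natl q k : q^`()`_k = k.+1%:R * q`_k.+1.
Proof. by rewrite coef_deriv mulr_natl. Qed.

(** The operator is triangular in the powers of x, with three diagonals. *)
Lemma coef_jacobi_op q k : (jacobi_op q)`_k =
  - jacobi_eigenvalue k * q`_k + (b - a) * k.+1%:R * q`_k.+1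
  + k.+2%:R * k.+1%:R * q`_k.+2.
Proof.
rewrite /jacobi_op /jacobi_tau /jacobi_eigenvalue.
rewrite !mulrBl mul1r mul_polyC -scalerAl !(coefD, coefN, coefZ).
rewrite coefXnM coefXM.
case: k => [|[|k]] /=; rewrite ?subn2 /= !coef_deriv_natl.
- by ring.
- by ring.
- by rewrite -!natr1; ring.
Qed.

Lemma jacobi_op_linear : linear jacobi_op.
Proof.
move=> c p q; apply/polyP => k.
by rewrite !(coefD, coefZ, coef_jacobi_op); ring.
Qed.

(** The difference is (n - m) (n + m + a + b + 1), where n + m >= 1 and
    a + b > -2. *)
Lemma jacobi_eigenvalue_neq m n : (m < n)%N ->
  jacobi_eigenvalue n - jacobi_eigenvalue m != 0.
Proof.
move: a1 b1 => ha hb mn; rewrite /jacobi_eigenvalue.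
have -> : n%:R * (n%:R + a + b + 1) - m%:R * (m%:R + a + b + 1) =
  (n%:R - m%:R) * (n%:R + m%:R + a + b + 1) by ring.
have n1 : 1 <= n%:R :> R by rewrite ler1n; case: n mn.
have m0 : 0 <= m%:R :> R by [].
have mnR : m%:R < n%:R :> R by rewrite ltr_nat.
by apply: mulf_neq0; apply: lt0r_neq0; lra.
Qed.

(** The operator shifted by the n-th eigenvalue is triangular with nonzero
    diagonal below degree n, so the equation is solved from the leading
    coefficient down. *)
Lemma jacobi_op_solve n m q : (m <= n)%N -> (size q <= m)%N ->
  exists2 r : {poly R}, (size r <= m)%N & jacobi_op r + jacobi_eigenvalue n *: r = q.
Proof.
elim: m q => [|m IHm] q mn sq.
  exists 0; rewrite ?size_poly0 //; apply/polyP => k.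
  rewrite coefD coefZ coef_jacobi_op !coef0; move/leq_sizeP : sq => -> //; ring.
pose c := q`_m / (jacobi_eigenvalue n - jacobi_eigenvalue m).
pose s := c *: 'X^m.
pose q' := q - (jacobi_op s + jacobi_eigenvalue n *: s).
have cs j : s`_j = c * (j == m)%:R by rewrite coefZ coefXn.
have [|r sr rE] := IHm q' (ltnW mn).
  apply/leq_sizeP => j mj.
  rewrite /q' coefB coefD (coefZ _ s) coef_jacobi_op !cs.
  rewrite (_ : (j.+1 == m) = false); last by lia.
  rewrite (_ : (j.+2 == m) = false); last by lia.
  rewrite !mulr0 !addr0.
  move: mj; rewrite leq_eqVlt => /predU1P[<-|mj].
    rewrite eqxx !mulr1 /c; field; exact: jacobi_eigenvalue_neq.
  by rewrite (gtn_eqF mj) !mulr0 addr0 subr0; move/leq_sizeP : sq; apply.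
exists (s + r).
  apply/leq_sizeP => j mj; rewrite coefD cs gtn_eqF // mulr0 add0r.
  by move/leq_sizeP : sr; apply; exact: ltnW.
have -> : q = q' + (jacobi_op s + jacobi_eigenvalue n *: s) by rewrite subrK.
by rewrite -rE -{1}[s]scale1r jacobi_op_linear scale1r scalerDr; ring.
Qed.

(** The operator plus the n-th eigenvalue maps x^n to a polynomial of degree
    less than n, which is also the image of some r of degree less than n; hence
    it annihilates x^n - r. *)
Lemma jacobi_eigenpolynomial n :
  exists p, [/\ p \is monic, size p = n.+1 &
    jacobi_op p = - jacobi_eigenvalue n *: p].
Proof.
pose q : {poly R} := jacobi_op 'X^n + jacobi_eigenvalue n *: 'X^n.
have [||r sr rE] := @jacobi_op_solve n n q => //.
  apply/leq_sizeP => j nj.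
  rewrite /q coefD coefZ coef_jacobi_op !coefXn.
  rewrite (_ : (j.+1 == n) = false); last by lia.
  rewrite (_ : (j.+2 == n) = false); last by lia.
  rewrite !mulr0 !addr0.
  move: nj; rewrite leq_eqVlt => /predU1P[<-|nj]; first by ring.
  by rewrite (gtn_eqF nj) !mulr0 addr0.
have srn : (size (- r) < size ('X^n : {poly R}))%N by rewrite size_polyXn size_polyN ltnS.
exists ('X^n - r); split.
- by rewrite monicE lead_coefDl // lead_coefXn.
- by rewrite size_polyDl // size_polyXn.
- rewrite addrC -scaleN1r jacobi_op_linear.
  have -> : jacobi_op 'X^n = q - jacobi_eigenvalue n *: 'X^n by rewrite addrK.
  by rewrite -rE -!mul_polyC; ring.
Qed.

Definition jacobi_eigenseq (P : nat -> {poly R}) : Prop :=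
  monic_seq P /\
  forall n, jacobi_op (P n) = - jacobi_eigenvalue n *: P n.

Lemma jacobi_eigenseq_ex : exists P, jacobi_eigenseq P.
Proof.
have [P PE] := choice jacobi_eigenpolynomial.
by exists P; split=> n; have [] := PE n.
Qed.

(** Comparing the coefficients of x^n in the eigenvalue equation; the
    denominator is the difference of the eigenvalues n+1 and n. *)
Lemma eigenseq_subleading_coef P n : jacobi_eigenseq P ->
  (P n.+1)`_n = n.+1%:R * (a - b) / (2 * n.+1%:R + a + b).
Proof.
move: a1 b1 => ha hb [mP] /(_ n.+1) /(congr1 (fun q : {poly R} => q`_n)).
rewrite coefZ coef_jacobi_op (monic_seq_coef _ mP) (monic_seq_coef_gt mP (ltnSn _)).
have n0 : 0 <= n%:R :> R by [].
have d0 : 2 * n.+1%:R + a + b != 0 by rewrite -(natr1 n); apply: lt0r_neq0; lra.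
move=> e; apply: (mulIf d0); rewrite divfK //.
by move: e; rewrite /jacobi_eigenvalue -!natr1 => e; lra.
Qed.

(** Here the denominator is the difference of the eigenvalues n+2 and n. *)
Lemma eigenseq_third_coef P n : jacobi_eigenseq P ->
  (P n.+2)`_n = - (n.+2%:R * n.+1%:R + (b - a) * n.+1%:R * (P n.+2)`_n.+1)
                / (2 * (2 * n.+2%:R + a + b - 1)).
Proof.
move: a1 b1 => ha hb [mP] /(_ n.+2) /(congr1 (fun q : {poly R} => q`_n)).
rewrite coefZ coef_jacobi_op (monic_seq_coef _ mP).
have n0 : 0 <= n%:R :> R by [].
have d0 : 2 * (2 * n.+2%:R + a + b - 1) != 0.
  by rewrite -!natr1; apply: lt0r_neq0; lra.
move=> e; apply: (mulIf d0); rewrite divfK //.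
by move: e; rewrite /jacobi_eigenvalue -!natr1 => e; lra.
Qed.

(** By Pearson's identity for q p' and for p q' the operator is symmetric for L,
    and eigenvectors of a symmetric operator with distinct eigenvalues are
    orthogonal. *)
Lemma pearson_orthogonal (L : {scalar {poly R}}) m n p q :
  (forall r : {poly R}, L ((1 - 'X ^+ 2) * r^`() + jacobi_tau * r) = 0) ->
  m <> n ->
  jacobi_op p = - jacobi_eigenvalue m *: p ->
  jacobi_op q = - jacobi_eigenvalue n *: q ->
  L (p * q) = 0.
Proof.
move=> LP mn pE qE.
have H : L (q * jacobi_op p - p * jacobi_op q) = 0.
  have -> : q * jacobi_op p - p * jacobi_op q =
     ((1 - 'X ^+ 2) * (q * p^`())^`() + jacobi_tau * (q * p^`())) -
     ((1 - 'X ^+ 2) * (p * q^`())^`() + jacobi_tau * (p * q^`())).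
    by rewrite /jacobi_op !derivM; ring.
  by rewrite linearB /= !LP subrr.
have E : q * jacobi_op p - p * jacobi_op q =
    (jacobi_eigenvalue n - jacobi_eigenvalue m) *: (p * q).
  by rewrite pE qE -!mul_polyC; ring.
move: H; rewrite E linearZ /= => /eqP; rewrite mulf_eq0 => /orP[|/eqP//].
have [mn'|nm|//] := ltngtP m n; first by rewrite (negPf (jacobi_eigenvalue_neq mn')).
by rewrite -opprB oppr_eq0 (negPf (jacobi_eigenvalue_neq nm)).
Qed.

(** The two properties of integration against the Jacobi weight on which the
    algebraic part rests: positive definiteness and Pearson's identity. *)
Definition jacobi_functional (L : {poly R} -> R) : Prop :=
  (forall p : {poly R}, p != 0 -> 0 < L (p * p)) /\
  (forall r : {poly R}, L ((1 - 'X ^+ 2) * r^`() + jacobi_tau * r) = 0).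

Lemma eigenseq_orthogonal (L : {scalar {poly R}}) P :
  jacobi_functional L -> jacobi_eigenseq P ->
  forall i j, i <> j -> L (P i * P j) = 0.
Proof. by move=> [_ LP] [_ PE] i j ij; apply: (pearson_orthogonal LP ij). Qed.

Lemma eigenseq_orthogonal_lower (L : {scalar {poly R}}) P n q :
  jacobi_functional L -> jacobi_eigenseq P -> (size q <= n)%N -> L (q * P n) = 0.
Proof.
move=> LJ PE; apply: (orthogonal_lower_degree PE.1).
exact: eigenseq_orthogonal LJ PE.
Qed.

(** The difference of both sides has degree less than n, by the closed forms of
    the coefficients of degree n+1 and n, and it is orthogonal to these degrees,
    because r * 'X has degree at most n when r has degree less than n. *)
Lemma eigenseq_three_term (L : {scalar {poly R}}) P n :
  jacobi_functional L -> jacobi_eigenseq P ->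
  P n.+2 = ('X - (c_J a b n.+2)%:P) * P n.+1 - lambda_J a b n.+2 *: P n.
Proof.
move: a1 b1 => ha hb LJ PE; have [mP _] := PE.
set c := c_J _ _ _; set l := lambda_J _ _ _.
apply/eqP; rewrite -subr_eq0; apply/eqP; apply: (orthogonal_self_eq0 LJ.1 (n := n)).
  have cq k : (P n.+2 - (('X - c%:P) * P n.+1 - l *: P n))`_k =
      (P n.+2)`_k - (if k is j.+1 then (P n.+1)`_j else 0) + c * (P n.+1)`_k
      + l * (P n)`_k.
    rewrite mulrBl mul_polyC !(coefD, coefN, coefZ) coefXM.
    by case: k => [|k] /=; ring.
  have n0 : 0 <= n%:R :> R by [].
  apply/leq_sizeP => k nk; rewrite cq.
  have [->|[->|k3]] : k = n \/ k = n.+1 \/ (n.+1 < k)%N by lia.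
  - rewrite (monic_seq_coef _ mP) (eigenseq_third_coef _ PE).
    rewrite !(eigenseq_subleading_coef _ PE).
    (* For n = 0 the product x P_1 has no constant term, and lambda_2 has its
       common factor cancelled. *)
    case: n n0 @c @l {cq nk} => [|m] _ c l.
      rewrite /c /l /c_J /lambda_J /=.
      have d2 : 2 + a + b != 0 by apply: lt0r_neq0; lra.
      have d3 : 3 + a + b != 0 by apply: lt0r_neq0; lra.
      have d4 : 4 + a + b != 0 by apply: lt0r_neq0; lra.
      by field; lra.
    have m0 : 0 <= m%:R :> R by [].
    rewrite (eigenseq_third_coef _ PE) !(eigenseq_subleading_coef _ PE).
    rewrite /c /l /c_J /lambda_J /= -!natr1.
    by field; lra.
  - rewrite !(eigenseq_subleading_coef _ PE) (monic_seq_coef _ mP).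
    rewrite (monic_seq_coef_gt mP (ltnSn _)).
    by rewrite /c /c_J /= -!natr1; field; lra.
  - case: k k3 {nk} => // k k3; have kn : (n < k)%N by lia.
    have [kE|k2] : k = n.+1 \/ (n.+1 < k)%N by lia.
      rewrite kE !(monic_seq_coef _ mP) !(monic_seq_coef_gt mP) //; ring.
    by rewrite !(monic_seq_coef_gt mP); [ring|lia..].
move=> r sr; rewrite !mulrBr !mulrBl mulrBr -scalerAr mul_polyC -scalerAr mulrA.
rewrite !linearB /= !linearZ /= !(eigenseq_orthogonal_lower LJ PE) //.
- by ring.
- by lia.
- by rewrite (leq_trans (size_polyMleq _ _)) // size_polyX addn2.
- by lia.
Qed.

End JacobiOperator.

(** M integrates against (1+x) w when L integrates against w. Hence P (n+1) is
    M-orthogonal to all polynomials of degree less than n, and gamma_(n+1) is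
    the difference of the subleading coefficients of P (n+1) and Q (n+1). *)
Lemma eigenseq_christoffel (R : realType) (a b : R) (L M : {scalar {poly R}})
    (P Q : nat -> {poly R}) (n : nat) : -1 < a -> -1 < b ->
  jacobi_functional a b L -> jacobi_eigenseq a b P ->
  jacobi_functional a (b + 1) M -> jacobi_eigenseq a (b + 1) Q ->
  (forall p : {poly R}, M p = L (p * ('X + 1))) ->
  P n.+1 = Q n.+1 + gamma_QC a b n.+1 *: Q n.
Proof.
move=> a1 b1 LJ PE MJ QE ML; have [mP _] := PE; have [mQ _] := QE.
have b2 : -1 < b + 1 by lra.
set g := gamma_QC _ _ _; apply/eqP; rewrite -subr_eq0; apply/eqP.
apply: (orthogonal_self_eq0 MJ.1 (n := n)).
  have n0 : 0 <= n%:R :> R by [].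
  apply/leq_sizeP => k nk; rewrite coefB coefD coefZ.
  have [->|[->|k3]] : k = n \/ k = n.+1 \/ (n.+1 < k)%N by lia.
  - rewrite (monic_seq_coef _ mQ) (eigenseq_subleading_coef _ _ _ PE) //.
    rewrite (eigenseq_subleading_coef _ _ _ QE) //.
    by rewrite /g /gamma_QC -!natr1; field; lra.
  - rewrite (monic_seq_coef _ mP) (monic_seq_coef _ mQ) (monic_seq_coef_gt mQ) //.
    by ring.
  - by rewrite (monic_seq_coef_gt mP) // !(monic_seq_coef_gt mQ); [ring|lia..].
move=> r sr; rewrite mulrBr mulrDr -scalerAr linearB linearD linearZ /=.
rewrite !(eigenseq_orthogonal_lower _ _ MJ QE) //; last by lia.
rewrite ML mulrAC (eigenseq_orthogonal_lower _ _ LJ PE) //; first by ring.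
rewrite (leq_trans (size_polyMleq _ _)) // -[1]/(1%:P) size_XaddC; lia.
Qed.

(** * Jacobi and quasi-Christoffel Jacobi polynomials *)

Section JacobiFamily.
Variables (R : realType) (a b : R).
Hypotheses (a1 : -1 < a) (b1 : -1 < b).
Implicit Type P : nat -> {poly R}.

Lemma jacobi_functional_ex :
  exists2 L : {scalar {poly R}}, L =1 jacobi_integral a b & jacobi_functional a b L.
Proof.
pose L : {scalar {poly R}} := HB.pack (jacobi_integral a b)
  (GRing.isLinear.Build R {poly R} R *%R _ (jacobi_integral_scalar a1 b1)).
exists L => //; split=> p; first exact: jacobi_integral_gt0.
exact: jacobi_integral_pearson.
Qed.

Lemma orthogonal_wrt_jacobiP P : monic_seq P ->
  orthogonal_wrt (jacobi_weight a b) (@jacobi_interval R) P <->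
  forall i j, i <> j -> jacobi_integral a b (P i * P j) = 0.
Proof.
move=> mP.
have fE i j : (fun x : R => (P i).[x] * (P j).[x] * jacobi_weight a b x) =
    (fun x : R => (P i * P j).[x] * jacobi_weight a b x).
  by apply/funext => x; rewrite hornerM.
split=> [oP i j /(oP i j).2.1|oP i j /=]; rewrite fE //.
split; first exact: poly_jacobi_integrable.
split=> [/oP //|->]; apply/eqP; rewrite gt_eqF //.
apply: jacobi_integral_gt0 => //; apply: monic_neq0; exact: (mP j).1.
Qed.

Lemma jacobi_is_monic_jacobi : is_monic_jacobi a b (jacobi a b).
Proof.
have [L LE LJ] := jacobi_functional_ex.
have [P PE] := jacobi_eigenseq_ex a1 b1.
apply: (@xgetPex _ _ [set p | is_monic_jacobi a b p]); exists P.
split; first exact: PE.1.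
apply/orthogonal_wrt_jacobiP; first exact: PE.1.
by move=> i j ij; rewrite -LE; apply: (eigenseq_orthogonal a1 b1 LJ PE ij).
Qed.

(** The eigenpolynomials form a monic orthogonal family, and such a family is
    unique. *)
Lemma jacobi_eigenseqP : jacobi_eigenseq a b (jacobi a b).
Proof.
have [L LE LJ] := jacobi_functional_ex.
have [P PE] := jacobi_eigenseq_ex a1 b1.
have [mJ /(orthogonal_wrt_jacobiP mJ) oJ] := jacobi_is_monic_jacobi.
suff -> : jacobi a b = P by [].
apply/funext; apply: (monic_orthogonal_unique LJ.1) => //.
- by move=> i j /oJ; rewrite -LE.
- exact: PE.1.
- by move=> i j; exact: (eigenseq_orthogonal a1 b1 LJ PE).
Qed.

End JacobiFamily.

Lemma JQC_jacobi (R : realType) (a b : R) n : -1 < a -> -1 < b ->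
  JQC a b n = jacobi a b n.
Proof.
move=> a1 b1; have b2 : -1 < b + 1 by lra.
have PE := jacobi_eigenseqP a1 b1.
case: n => [|n].
  have [/monicP m0 s0] := PE.1 0%N; rewrite [RHS]size1_polyC ?s0 //.
  by move: m0; rewrite lead_coefE s0 => ->.
have [L LE LJ] := jacobi_functional_ex a1 b1.
have [M ME MJ] := jacobi_functional_ex a1 b2.
rewrite /JQC (eigenseq_christoffel n a1 b1 LJ PE MJ (jacobi_eigenseqP a1 b2)) //.
by move=> p; rewrite ME LE jacobi_integral_christoffel.
Qed.

(** For n = m + 2 all factors of the denominators, and the numerators of gamma_n
    and gamma_(n-1), are positive because a, b > -1. *)
Lemma gamma_QC_difference (R : realType) (a b : R) n : -1 < a -> -1 < b ->
  (2 <= n)%N ->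
  c_c a b n.+1 - c_c a b n + gamma_QC a b n - gamma_QC a b n.+1
  - lambda_c a b n.+1 / gamma_QC a b n + lambda_c a b n / gamma_QC a b n.-1 = 0.
Proof.
move=> a1 b1; case: n => [|[|m]] // _.
rewrite /c_c /gamma_QC /lambda_c /= -!natr1.
have : 0 <= m%:R :> R by [].
move: (m%:R : R) => x x0.
by field; lra.
Qed.

Theorem mainTheorem3 (R : realType) (alpha beta : R)
    (halpha : -1 < alpha) (hbeta : -1 < beta) :
  (forall n : nat, (2 <= n)%N ->
     c_c alpha beta n.+1 - c_c alpha beta n
     + gamma_QC alpha beta n - gamma_QC alpha beta n.+1
     - lambda_c alpha beta n.+1 / gamma_QC alpha beta n
     + lambda_c alpha beta n / gamma_QC alpha beta n.-1 = 0)
  /\ (forall n : nat, (1 <= n)%N ->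
     JQC alpha beta n = jacobi alpha beta n)
  /\ (forall n : nat, (1 <= n)%N ->
     JQC alpha beta n.+1 =
       ('X - (c_J alpha beta n.+1)%:P) * JQC alpha beta n
       - lambda_J alpha beta n.+1 *: JQC alpha beta n.-1)
  /\ orthogonal_wrt (jacobi_weight alpha beta) (@jacobi_interval R)
       (JQC alpha beta).
Proof.
have JE : JQC alpha beta = jacobi alpha beta.
  by apply/funext => n; exact: JQC_jacobi.
have [L _ LJ] := jacobi_functional_ex halpha hbeta.
split; first by move=> n; exact: gamma_QC_difference.
rewrite JE; split=> //; split; last exact: (jacobi_is_monic_jacobi halpha hbeta).2.
case=> // n _.
exact: (eigenseq_three_term halpha hbeta n LJ (jacobi_eigenseqP halpha hbeta)).
Qed.
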